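(* Let $r\ge 2$ be an integer. Then the function $$p\mapsto \mathrm{low}_r(p)+\tfrac12\big(p\log p+(1-p)\log(1-p)\big),\qquad p\in[0,1],$$ is concave on $[0,1]$.
   Context: For a finite graph $G$ (multiple edges allowed) and $l\in\mathbb{Z}_{\ge0}$, $\phi(l,G)$ denotes the number of $l$-matchings of $G$, i.e. sets of $l$ pairwise vertex-disjoint edges ($\phi(0,G)=1$). Let $\mathcal{G}(2n,r)$ be the set of $r$-regular bipartite graphs on $2n$ vertices, multiple edges allowed, and for $l\in\{0,\dots,n\}$ let $\mu(l,2n,r):=\min_{G\in\mathcal{G}(2n,r)}\phi(l,G)$. For $p\in[0,1]$, $\mathrm{low}_r(p)$ is the infimum of $\liminf_{k\to\infty}\frac{\log\mu(l_k,2n_k,r)}{2n_k}$ over all sequences of integers $n_k\to\infty$ and $0\le l_k\le n_k$ with $\lim_{k\to\infty} l_k/n_k=p$. Convention: $0\log 0=0$. *)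

(* Defs.v *)
From mathcomp Require Import all_boot all_order all_algebra.
From mathcomp Require Import all_classical all_reals all_analysis.
Import Order.TTheory GRing.Theory Num.Theory.
Import numFieldNormedType.Exports.

Set Implicit Arguments.
Unset Strict Implicit.
Unset Printing Implicit Defensive.

Local Open Scope ring_scope.

(** Edges form a type of their own, so parallel edges are distinct objects; an
    edge has exactly two ends, so there are no loops. *)
Record multigraph := Multigraph {
  vert : finType;
  edge : finType;
  ends : edge -> {set vert};
  card_ends : forall e, #|ends e| = 2%N }.

Definition regular (r : nat) (G : multigraph) : Prop :=
  forall v : vert G, #|[set e : edge G | v \in ends e]| = r.

Definition bipartite (G : multigraph) : Prop :=
  exists A : {set vert G}, forall e : edge G,
    #|ends e :&: A| = 1%N /\ #|ends e :\: A| = 1%N.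

Definition matching (G : multigraph) (M : {set edge G}) : bool :=
  [forall e in M, forall f in M, (e != f) ==> [disjoint ends e & ends f]].

Definition phi (l : nat) (G : multigraph) : nat :=
  #|[set M : {set edge G} | matching M & #|M| == l]|.

Definition regular_bipartite (N r : nat) (G : multigraph) : Prop :=
  [/\ #|vert G| = N, regular r G & bipartite G].

(** Non-emptiness of the class: a perfect matching with every edge repeated
    [r] times. *)
Section witness.
Variables (n r : nat).

Definition witness_ends (e : 'I_n * 'I_r) : {set bool * 'I_n} :=
  [set (true, e.1); (false, e.1)].

Fact witness_card_ends e : #|witness_ends e| = 2%N.
Proof. by rewrite cards2. Qed.

Definition witness := Multigraph witness_card_ends.

Lemma mem_witness_ends (x : bool * 'I_n) (e : 'I_n * 'I_r) :
  (x \in witness_ends e) = (x.2 == e.1).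
Proof. by case: x => -[] i; rewrite !inE !xpair_eqE/= ?orbF. Qed.

Lemma witness_regular_bipartite : regular_bipartite (2 * n) r witness.
Proof.
split => [|v|].
- by rewrite card_prod card_bool card_ord.
- transitivity #|[set ((v : bool * 'I_n).2, j) | j in [set: 'I_r]]|; last first.
    by rewrite card_imset ?cardsT ?card_ord// => i j [].
  apply: eq_card => -[i j]; rewrite [LHS]finset.in_set /= mem_witness_ends /=.
  apply/eqP/imsetP => [vi|[k _ [-> _]]]; last by [].
  by exists j; [rewrite finset.in_setT|rewrite vi].
- pose A : {set bool * 'I_n} := [set x | x.1].
  have memA x : (x \in A) = x.1 by rewrite finset.in_set.
  exists A => e.
  split; [rewrite -(cards1 (true, e.1))|rewrite -(cards1 (false, e.1))];
    apply: eq_card => -[b i];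
    rewrite ?finset.in_setI ?finset.in_setD finset.in_set1 memA;
    by rewrite mem_witness_ends xpair_eqE /=; case: b; rewrite ?andbT ?andbF.
Qed.

Lemma card_edge_witness : #|edge witness| = (n * r)%N.
Proof. by rewrite card_prod !card_ord. Qed.

End witness.

Lemma ex_phi (l n r : nat) :
  exists m, `[< exists2 G, regular_bipartite (2 * n) r G & phi l G = m >].
Proof.
exists (phi l (witness n r)); apply/asboolP.
by exists (witness n r) => //; exact: witness_regular_bipartite.
Qed.

(** [mu l n r] is the minimum over graphs with [2 * n] vertices. *)
Definition mu (l n r : nat) : nat := ex_minn (ex_phi l n r).

Lemma mu_le (l n r : nat) : (mu l n r <= 2 ^ (n * r))%N.
Proof.
rewrite /mu; case: ex_minnP => m _ /(_ (phi l (witness n r))) h.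
apply: leq_trans (h _) _.
  apply/asboolP; exists (witness n r) => //.
  exact: witness_regular_bipartite.
rewrite /phi -(card_edge_witness n r) -[in X in (_ <= X)%N]cardsT -card_powerset.
by apply: subset_leq_card; apply/fintype.subsetP => M _; rewrite powersetE finset.subsetT.
Qed.

Section low.
Local Open Scope classical_set_scope.
Variable R : realType.

(** Every [r]-regular bipartite graph with [r >= 1] has a perfect matching, so
    [mu l n r] is positive for [l <= n] and [ln] never takes its default value
    at [0]; [n k] is eventually positive, hence so is the denominator. *)
Definition log_mu_density (r : nat) (n l : nat -> nat) (k : nat) : R :=
  ln (mu (l k) (n k) r)%:R / (2 * n k)%:R.

Definition admissible (p : R) (n l : nat -> nat) : Prop :=
  [/\ n k @[k --> \oo] --> \oo,
      forall k, (l k <= n k)%N &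
      (l k)%:R / (n k)%:R @[k --> \oo] --> p].

Definition elow (r : nat) (p : R) : \bar R :=
  ereal_inf [set x | exists n l : nat -> nat, admissible p n l /\
    x = limn_einf (EFin \o log_mu_density r n l)].

Definition low (r : nat) (p : R) : R := fine (elow r p).

Lemma log_mu_density_ge0 r n l k : 0 <= log_mu_density r n l k.
Proof.
rewrite divr_ge0//; have [->|m0] := posnP (mu (l k) (n k) r).
  by rewrite ln0.
by rewrite ln_ge0// ler1n.
Qed.

Lemma log_mu_density_le r n l k :
  log_mu_density r n l k <= r%:R * ln 2.
Proof.
have ln2 : 0 <= ln (2 : R) by rewrite ln_ge0// ler1n.
have h : ln (mu (l k) (n k) r)%:R <= (n k * r)%:R * ln (2 : R).
  have [->|m0] := posnP (mu (l k) (n k) r).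
    by rewrite ln0// mulr_ge0.
  rewrite mulr_natl -lnXn// ler_ln ?posrE ?ltr0n ?exprn_gt0//.
  by rewrite -natrX ler_nat mu_le.
rewrite /log_mu_density; have [->|n0] := posnP (n k).
  by rewrite muln0 invr0 mulr0 mulr_ge0.
rewrite ler_pdivrMr ?ltr0n ?muln_gt0//; apply: le_trans h _.
rewrite mulrAC ler_wpM2r// -natrM ler_nat mulnC leq_mul2l.
by rewrite leq_pmull ?orbT.
Qed.

Lemma ex_admissible (p : R) : 0 <= p <= 1 -> exists n l, admissible p n l.
Proof.
move=> /andP[p0 p1]; exists id, (fun k => Num.truncn (p * k%:R)); split.
- exact: cvg_id.
- move=> k; rewrite -(ler_nat R).
  apply: le_trans (_ : p * k%:R <= _); last by rewrite ler_piMl.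
  by rewrite truncn_le mulr_ge0.
- apply: (@squeeze_cvgr _ _ _ _ (fun k : nat => p - k%:R^-1) (fun=> p)).
  + near=> k.
    have k0 : 0 < k%:R :> R by rewrite ltr0n; near: k; exists 1%N.
    have /andP[h1 h2] := truncn_itv (mulr_ge0 p0 (ltW k0)).
    rewrite ler_pdivrMr// h1 andbT ler_pdivlMr// mulrBl mulVf ?gt_eqF//.
    by rewrite lerBlDr natr1 ltW.
  + rewrite -[X in _ --> X]subr0; apply: cvgB; first exact: cvg_cst.
    by rewrite -cvg_shiftS /=; exact: cvg_harmonic.
  + exact: cvg_cst.
Unshelve. all: by end_near. Qed.

(** [low] is thus really an infimum of real numbers. *)
Lemma elow_fin_num r (p : R) : 0 <= p <= 1 -> elow r p \is a fin_num.
Proof.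
move=> /ex_admissible[n [l nl]]; rewrite fin_real//; apply/andP; split.
- apply: (@lt_le_trans _ _ 0%E); first exact: ltNy0.
  apply: le_ereal_inf_tmp => _ [n' [l' [_ ->]]].
  rewrite limn_einf_lim; apply: lime_ge; first exact: is_cvg_einfs.
  apply: nearW => k; apply: le_ereal_inf_tmp => _ [m _ <-].
  by rewrite /= lee_fin log_mu_density_ge0.
- apply: (@le_lt_trans _ _ (r%:R * ln 2 : R)%:E); last exact: ltry.
  apply: (@le_trans _ _ (limn_einf (EFin \o log_mu_density r n l))).
    by apply: ereal_inf_lbound; exists n, l.
  rewrite limn_einf_lim; apply: lime_le; first exact: is_cvg_einfs.
  apply: nearW => k; apply: ereal_inf_le.
  exists (EFin (log_mu_density r n l k)); first by exists k => /=.
  by rewrite lee_fin log_mu_density_le.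
Qed.

End low.

Local Open Scope convex_scope.

(** The mirror image of [convex_function]. *)
Definition concave_function (R : numFieldType) (E : lmodType R)
    (E' := convex_lmodType E) (D : set E') (f : E' -> R^o) : Prop :=
  forall t : {i01 R},
    {in D &, forall x y : E', (f x <| t |> f y <= f (x <| t |> y))%R}.

(* Main.v *)
Require Import Defs.
From mathcomp Require Import all_boot all_order all_algebra.
From mathcomp Require Import complex realalg ring lra zify.
Import Order.TTheory GRing.Theory Num.Theory.

Set Implicit Arguments.
Unset Strict Implicit.
Unset Printing Implicit Defensive.

(** Fix a graph G with 2n vertices and a perfect matching. By Heilmann and Lieb,
    the polynomial sum_l phi(l, G) y^l has n negative real roots, so by Newton's
    inequalities phi(l, G) / 'C(n, l) is a log-concave sequence in l. Regular
    bipartite graphs have perfect matchings (Hall), and log-concavity survives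
    the minimum over G: ln mu(l, 2n, r) - ln 'C(n, l) is concave in l. Since
    (2n)^-1 ln 'C(n, l) tends to -(p ln p + (1-p) ln (1-p))/2 as l/n tends to p,
    the statement is the limit of this discrete concavity: a sequence (n_k, l_k)
    with l_k/n_k -> z is interpolated between floor (x n_k) and floor (y n_k). *)

Local Open Scope ring_scope.

(** * The matching polynomial *)

Lemma Im_gt0_neq0 (C : numClosedFieldType) (z : C) : 0 < 'Im z -> z != 0.
Proof. by apply: contraTneq => ->; rewrite (Creal_ImP _ (real0 _)) ltxx. Qed.

Lemma Im_opp_inv_gt0 (C : numClosedFieldType) (z : C) :
  0 < 'Im z -> 0 < 'Im (- z^-1).
Proof.
move=> z0; rewrite raddfN /= ImV mulNr opprK divr_gt0 // exprn_gt0 //.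
by rewrite normr_gt0 Im_gt0_neq0.
Qed.

Lemma Im_add_sum_gt0 (C : numClosedFieldType) (I : finType) (P : pred I)
    (x : C) (F : I -> C) : 0 < 'Im x -> (forall i, P i -> 0 < 'Im (F i)) ->
  0 < 'Im (x + \sum_(i | P i) F i).
Proof.
move=> x0 F0; rewrite raddfD raddf_sum /= ltr_wpDr // sumr_ge0 // => i /F0.
exact: ltW.
Qed.

Section MatchingSum.
Variable G : multigraph.
Implicit Types (S : {set vert G}) (M : {set edge G}) (e : edge G).

Definition inside S M := [forall e in M, ends e \subset S].

Lemma insideP S M :
  reflect (forall e, e \in M -> ends e \subset S) (inside S M).
Proof. exact: forall_inP. Qed.

Lemma matchingP M :
  reflect {in M &, forall e f, e != f -> [disjoint ends e & ends f]}
    (matching M).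
Proof.
apply: (iffP forall_inP) => [h e f eM fM ef|h e eM].
  by have /forall_inP/(_ _ fM)/implyP := h e eM; exact.
by apply/forall_inP => f fM; apply/implyP; exact: h.
Qed.

(** Restricting to a vertex set [S] keeps vertex deletion inside the fixed graph [G], with no
    induced multigraph to build. *)
Definition matching_sum (C : comNzRingType) (y : C) S : C :=
  \sum_(M : {set edge G} | matching M && inside S M) y ^+ #|M|.

(** The conjunct [(e |: M) :\ e == M] encodes that [e] is not in [M], in the shape that
    [reindex_onto] produces in the recurrence below. *)
Lemma matching_setU1 S e M : ends e \subset S ->
  [&& matching (e |: M), inside S (e |: M) & (e |: M) :\ e == M] =
  matching M && inside (S :\: ends e) M.
Proof.
move=> eS; apply/and3P/andP => [[/matchingP mM /insideP iM /eqP eM]|].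
  have eNM : e \notin M by rewrite -eM !inE eqxx.
  split; first by apply/matchingP => f g fM gM; apply: mM;
    rewrite !inE ?fM ?gM orbT.
  apply/insideP => f fM; rewrite subsetD iM ?inE ?fM ?orbT//=.
  apply: mM; rewrite ?inE ?eqxx ?fM ?orbT//.
  by apply: contraNneq eNM => <-.
move=> [/matchingP mM /insideP iM].
have dj f : f \in M -> [disjoint ends f & ends e].
  by move=> /iM; rewrite subsetD => /andP[].
have eNM : e \notin M.
  apply/negP => /dj; rewrite -setI_eq0 setIid -cards_eq0 card_ends //.
split.
- apply/matchingP => f g; rewrite !inE.
  move=> /orP[/eqP->|fM] /orP[/eqP->|gM] fg; rewrite ?eqxx// in fg *.
  + by rewrite disjoint_sym dj.
  + exact: dj.
  + exact: mM.
- apply/insideP => f; rewrite !inE => /orP[/eqP->//|/iM].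
  by rewrite subsetD => /andP[].
- by rewrite setU1K.
Qed.

(** A matching inside [S] either avoids [v] or covers it by exactly one edge [e]; removing [e]
    leaves a matching inside [S :\: ends e]. *)
Lemma matching_sum_rec (C : comNzRingType) (y : C) S v : v \in S ->
  matching_sum y S = matching_sum y (S :\ v) +
    y * \sum_(e | (v \in ends e) && (ends e \subset S))
          matching_sum y (S :\: ends e).
Proof.
move=> vS; rewrite {1}/matching_sum (bigID (inside (S :\ v))) /=.
congr (_ + _).
  apply: eq_bigl => M; rewrite -andbA; congr andb; apply/andP/idP => [[]//|iM].
  split=> //; apply/insideP => e /(insideP _ _ iM) /subset_trans; apply.
  exact: subD1set.
(* The inner sum has one term if [M] covers [v] and none otherwise, so the condition of covering [v]
   is absorbed before the sums are exchanged. *)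
transitivity (\sum_(M : {set edge G} | matching M && inside S M)
    \sum_(e | (v \in ends e) && (e \in M)) y ^+ #|M|).
  rewrite [RHS](bigID (inside (S :\ v))) /= [X in _ = X + _]big1 ?add0r.
    apply: eq_bigr => M /andP[/andP[/matchingP mM /insideP iM]].
    rewrite negb_forall_in => /exists_inP[e eM].
    rewrite subsetD1 iM//= negbK => ve.
    rewrite (big_pred1 e) // => f /=; apply/andP/eqP => [[vf fM]|->//].
    apply/eqP; apply: contraTT vf => fe.
    by have := mM _ _ fM eM fe; rewrite disjoint_sym => /disjointFr ->.
  move=> M /andP[_ /insideP iM]; rewrite big_pred0 // => e.
  by apply/negP => /andP[ve /iM]; rewrite subsetD1 ve andbF.
rewrite (exchange_big_dep (fun e => (v \in ends e) && (ends e \subset S))) /=;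
  last first.
  by move=> M e /andP[_ /insideP iM] /andP[-> /iM].
rewrite mulr_sumr; apply: eq_bigr => e /andP[ve eS].
rewrite mulr_sumr (reindex_onto (fun M => e |: M) (fun M => M :\ e)) /=;
  last first.
  by move=> M /andP[_ /andP[_ eM]]; rewrite setD1K.
apply: eq_big => [M|M /andP[/andP[_ _] /eqP eM]].
  by rewrite -(matching_setU1 _ eS) ve setU11 /= andbT -!andbA.
have eNM : e \notin M by rewrite -eM setD11.
by rewrite cardsU1 eNM exprS.
Qed.

(* The recurrence reads [q S v = x - sum_u 1 / q (S - v) u] for
   [q S v := x * P S / P (S - v)], and [z |-> - 1/z] preserves the upper
   half-plane. *)
Lemma matching_sum_stable (C : numClosedFieldType) (x : C) S : 0 < 'Im x ->
  matching_sum (- x ^- 2) S != 0 /\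
  forall v, v \in S ->
    0 < 'Im (x * matching_sum (- x ^- 2) S / matching_sum (- x ^- 2) (S :\ v)).
Proof.
move=> x0; set y := - x ^- 2.
have xN0 := Im_gt0_neq0 x0.
have [k] := ubnP #|S|; elim: k S => // k IH S; rewrite ltnS => Sk.
have step v : v \in S ->
    0 < 'Im (x * matching_sum y S / matching_sum y (S :\ v)).
  move=> vS; have Sv : (#|S :\ v| < k)%N by rewrite (cardsD1 v) vS in Sk.
  have [Q0 Qv] := IH _ Sv.
  rewrite (matching_sum_rec _ vS) mulrDr mulrDl mulfK // mulrA.
  rewrite mulr_sumr mulr_suml; apply: Im_add_sum_gt0 => // e /andP[ve eS].
  have [u ue uv] : exists2 u, u \in ends e & u != v.
    have : (0 < #|ends e :\ v|)%N by have := cardsD1 v (ends e);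
      rewrite ve card_ends add1n => -[<-].
    by rewrite card_gt0 => /set0Pn[u]; rewrite !inE => /andP[]; exists u.
  have eE : S :\: ends e = S :\ v :\ u.
    rewrite setDDl; congr setD; apply/eqP;
      rewrite eq_sym eqEcard subUset !sub1set ve ue.
    by rewrite card_ends cardsU1 !inE eq_sym uv cards1.
  have uS : u \in S :\ v by rewrite !inE uv (subsetP eS).
  (* The choice of [y] enters here: [x * y = - x^-1], and [S :\: ends e] is [S] without [v] and the
     other end [u] of [e]. *)
  set P := matching_sum y; suff -> : x * y * P (S :\: ends e) / P (S :\ v) =
    - (x * P (S :\ v) / P (S :\ v :\ u))^-1 by exact/Im_opp_inv_gt0/Qv.
  rewrite -eE invf_div invfM /y; field; rewrite xN0 andbT; exact: Q0.
(* For empty [S] the sum is 1; otherwise it is a factor of a number with positive imaginary part. *)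
split=> //; have [->|/set0Pn[v vS]] := eqVneq S set0.
  rewrite /matching_sum (big_pred1 set0) ?cards0 ?oner_neq0 // => M /=.
  apply/andP/eqP => [[_ /insideP iM]|->].
    apply/eqP; apply: contraT => /set0Pn[e /iM]; rewrite subset0 -cards_eq0.
    by rewrite card_ends.
  by split; [apply/matchingP|apply/insideP] => e; rewrite inE.
by have := Im_gt0_neq0 (step v vS);
  rewrite !mulf_eq0 !negb_or => /andP[/andP[]].
Qed.

End MatchingSum.

Section MatchingPolynomial.
Variable G : multigraph.

(** The signed matching polynomial of Heilmann and Lieb in [x] is, up to a power of [x], the value
    of this one at [- x ^- 2]. *)
Definition matching_poly (R : nzRingType) : {poly R} :=
  \sum_(M : {set edge G} | matching M) 'X^#|M|.

Lemma coef_matching_poly (R : nzRingType) l :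
  (matching_poly R)`_l = (phi l G)%:R.
Proof.
rewrite /matching_poly coef_sum /phi -sum1_card natr_sum.
rewrite big_mkcond [RHS]big_mkcond; apply: eq_bigr => M _.
rewrite inE; case: matching => //=; rewrite coefXn eq_sym.
by case: (_ == _).
Qed.

Lemma phi0 : phi 0 G = 1%N.
Proof.
rewrite /phi (_ : finset _ = [set set0]) ?cards1 //; apply/setP => M.
rewrite !inE cards_eq0; apply/andP/eqP => [[_ /eqP]|->] //; split=> //.
by apply/matchingP => e; rewrite inE.
Qed.

Lemma phi_vanish l : (#|vert G| < 2 * l)%N -> phi l G = 0%N.
Proof.
move=> lV; apply/eqP; rewrite cards_eq0; apply: contraT => /set0Pn[M].
rewrite inE => /andP[/matchingP mM /eqP Ml]; move: lV; rewrite ltnNge => /negP;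
  case.
(* Double counting of incidences: each edge of [M] has two ends, each vertex lies on at most one
   edge of [M]. *)
rewrite -Ml mulnC -sum_nat_const.
rewrite (eq_bigr (fun e => \sum_v (v \in ends e : nat)))%N; last first.
  by move=> e _; rewrite -(card_ends e) -sum1_card big_mkcond.
rewrite exchange_big /= -sum1_card; apply: leq_sum => v _.
case: (pickP [pred e in M | v \in ends e]) => [e /= /andP[eM ve]|Mv];
  last first.
  by rewrite big1 // => e eM; have := Mv e; rewrite /= eM /= => ->.
rewrite (bigD1 e) //= ve big1 // => f /andP[fM /mM fe].
by rewrite (disjointFl (fe _ _)).
Qed.

Lemma matching_poly_eval (C : numClosedFieldType) (y : C) :
  (matching_poly C).[y] = matching_sum (G := G) y [set: vert G].
Proof.
rewrite /matching_poly /matching_sum horner_sum.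
by apply: eq_big => [M|M _]; rewrite ?hornerXn //; case: matching => //=;
  apply/esym/insideP.
Qed.

(** Take [x] to be a square root of [- z^-1]. If [x] were not real, [x] or [- x] would lie in the
    upper half-plane, where [matching_sum_stable] forbids a zero. *)
Lemma matching_poly_root (C : numClosedFieldType) (z : C) :
  root (matching_poly C) z -> exists2 x, x \is Num.real & z = - x ^- 2.
Proof.
move=> /rootP; rewrite matching_poly_eval => z0.
have zN0 : z != 0.
  apply/eqP => zE; move: z0; rewrite zE -matching_poly_eval horner_coef0.
  by rewrite coef_matching_poly phi0; apply/eqP/oner_neq0.
have xE : z = - sqrtC (- z^-1) ^- 2 by rewrite sqrtCK invrN invrK opprK.
exists (sqrtC (- z^-1)) => //; move: (sqrtC _) xE => x xE.
have stab u : u ^+ 2 = x ^+ 2 -> ~~ (0 < 'Im u).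
  move=> ux; apply/negP => /(@matching_sum_stable G _ _ setT)[+ _].
  by rewrite ux -xE z0 eqxx.
apply/Creal_ImP; have := stab x erefl; have := stab (- x) (sqrrN x).
rewrite raddfN /= oppr_gt0.
by case: (real_ltgt0P (Creal_Im x)).
Qed.

End MatchingPolynomial.

(** The polynomial splits over the algebraically closed [R[i]]. Its roots [- x ^- 2] with [x] real
    are negative elements of [R], so the factorization descends to [R]. *)
Lemma matching_poly_factor (R : rcfType) (G : multigraph) :
  exists2 s : seq R, all (> 0) s &
    matching_poly G R =
      lead_coef (matching_poly G R) *: \prod_(b <- s) ('X + b%:P).
Proof.
pose f := real_complex R.
have mapE : matching_poly G R[i] = map_poly f (matching_poly G R).
  by apply/polyP => k; rewrite coef_map /= !coef_matching_poly [RHS]rmorph_nat.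
have [t tE] := closed_field_poly_normal (matching_poly G R[i]).
have lN0 : lead_coef (matching_poly G R[i]) != 0.
  rewrite lead_coef_eq0; apply/eqP => /polyP/(_ 0%N)/eqP.
  by rewrite coef_matching_poly phi0 coef0 oner_eq0.
have [s s0 ts] : exists2 s : seq R, all (> 0) s & t = [seq - f b | b <- s].
  have : all (fun z => root (matching_poly G R[i]) z && (z != 0)) t.
    apply/allP => z zt; have rz : root (matching_poly G R[i]) z.
      by rewrite tE rootZ // root_prod_XsubC.
    rewrite rz /=; apply: contraTneq rz => ->.
    by rewrite /root horner_coef0 coef_matching_poly phi0 oner_neq0.
  elim: t {tE} => [_|z t IH /= /andP[/andP[/matching_poly_root[x xR zE] zN0]
    /IH[s s0 ->]]].
    by exists [::].
  have xN0 : x != 0.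
    by apply: contraNneq zN0 => x0; rewrite zE x0 expr0n invr0 oppr0.
  exists ((complex.Re x) ^- 2 :: s) => /=.
    rewrite s0 andbT invr_gt0 exprn_even_gt0 //=.
    by apply: contraNneq xN0 => x0; rewrite -(RRe_real xR) x0.
  rewrite zE; congr (- _ :: _).
  by rewrite /f fmorphV rmorphXn; congr (_ ^- 2); exact/esym/RRe_real.
exists s => //; apply: (map_poly_inj f); rewrite -mapE tE.
have -> : lead_coef (matching_poly G R[i]) = f (lead_coef (matching_poly G R)).
  by rewrite mapE /f lead_coef_map.
rewrite /f map_polyZ rmorph_prod /= ts big_map; congr (_ *: _).
apply: eq_bigr => b _.
by rewrite rmorphD /= map_polyX map_polyC /= polyCN opprK.
Qed.

(** * Newton's inequalities *)

(** [p k] is a mean of products of elements of [s]. The inequalities are carried through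
    multiplication by one factor ['X + b%:P] at a time. *)
Lemma prod_XaddC_newton (R : realFieldType) (s : seq R) : all (> 0) s ->
  exists p : nat -> R, [/\
    forall k, (\prod_(b <- s) ('X + b%:P))`_k = 'C(size s, k)%:R * p k,
    forall k, (k <= size s)%N -> 0 < p k &
    forall k, (k.+2 <= size s)%N -> p k * p k.+2 <= p k.+1 ^+ 2].
Proof.
elim: s => [_|b s IH /= /andP[b0 /IH[p [pE p0 pN]]]].
  exists (fun=> 1); split=> [k|//|//]; rewrite big_nil coef1 mulr1.
  by case: k => [|k]; rewrite ?bin0 // bin0n.
set n := size s in pE p0 pN *.
(* Solves ['C(n.+1, k) q_k = 'C(n, k-1) p_(k-1) + b 'C(n, k) p_k] for [q_k]. At [k = 0] and
   [k = n.+1] the out-of-range value of [p] has coefficient 0. *)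
pose q k : R := (k%:R * p k.-1 + b * (n.+1 - k)%:R * p k) / n.+1%:R.
have n0 : n.+1%:R != 0 :> R by rewrite pnatr_eq0.
exists q; split => [k|k kn|k kn].
- rewrite big_cons mulrDl coefD coefXM coefCM !pE /q.
  apply: (mulIf n0); rewrite -[RHS]mulrA divfK // mulrDl.
  case: k => [|k] /=; first by rewrite !bin0 subn0; ring.
  have bk := mul_bin_diag n.+1 k; have bkS := mul_bin_down n.+1 k.+1.
  rewrite mulrDr.
  have -> : 'C(n.+1, k.+1)%:R * (k.+1%:R * p k) = (n.+1 * 'C(n, k))%:R * p k :>
    R.
    by rewrite bk natrM; ring.
  have -> : 'C(n.+1, k.+1)%:R * (b * (n.+1 - k.+1)%:R * p k.+1) =
      b * (n.+1 * 'C(n, k.+1))%:R * p k.+1 :> R.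
    by rewrite bkS natrM; ring.
  by rewrite !natrM; ring.
- rewrite divr_gt0 ?ltr0n //; case: k kn => [_|k kn] /=.
    by rewrite mul0r add0r subn0 !mulr_gt0 ?p0.
  rewrite ltr_wpDr ?mulr_gt0 ?ltr0n ?p0 //.
  have [kn1|nk] := leqP k.+1 n; first by rewrite !mulr_ge0 // ltW ?p0.
  have -> : (n.+1 - k.+1 = 0)%N by lia.
  by rewrite mulr0 mul0r.
- have x0 : 0 < p k by apply: p0; lia.
  have y0 : 0 < p k.+1 by apply: p0; lia.
  (* Out-of-range neighbours are replaced by 0: their coefficients vanish, and the inequalities [wy]
     and [xz] then hold at the boundary too. *)
  pose w := if k is j.+1 then p j else 0.
  pose z := if (k.+2 <= n)%N then p k.+2 else 0.
  have [m nE] : exists m, n = (k + m).+1 by exists (n - k.+1)%N; lia.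
  have -> : q k = (k%:R * w + b * m.+2%:R * p k) / n.+1%:R.
    rewrite /q /w (_ : n.+1 - k = m.+2)%N; last lia.
    by case: (k); rewrite ?mul0r.
  have -> : q k.+1 = (k.+1%:R * p k + b * m.+1%:R * p k.+1) / n.+1%:R.
    by rewrite /q (_ : n.+1 - k.+1 = m.+1)%N //; lia.
  have -> : q k.+2 = (k.+2%:R * p k.+1 + b * m%:R * z) / n.+1%:R.
    rewrite /q /z (_ : n.+1 - k.+2 = m)%N; last lia.
    case: leqP => // km; have -> : m = 0%N by lia.
    by rewrite mulr0 !mul0r.
  rewrite mulrACA exprMn expr2 ler_pM2r;
    last by rewrite mulr_gt0 // invr_gt0 ltr0n.
  have w0 : 0 <= w by rewrite /w; case: (k) kn => // j jn; apply/ltW/p0; lia.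
  have z0 : 0 <= z by rewrite /z; case: ifP => // /p0/ltW.
  have wy : w * p k.+1 <= p k ^+ 2.
    by rewrite /w; case: (k) kn => [_|j jn]; rewrite ?mul0r ?sqr_ge0 ?pN //;
      lia.
  have xz : p k * z <= p k.+1 ^+ 2.
    by rewrite /z; case: ifP => [/pN//|_]; rewrite mulr0 sqr_ge0.
  move: (p k) (p k.+1) w z x0 y0 w0 z0 wy xz => x y w z x0 y0 w0 z0 wy xz.
  (* Multiply [wy] by [xz] and cancel [x * y > 0]. *)
  have wz : w * z <= x * y.
    rewrite -(ler_pM2r (mulr_gt0 x0 y0)).
    have := ler_pM (mulr_ge0 w0 (ltW y0)) (mulr_ge0 (ltW x0) z0) wy xz.
    by congr (_ <= _); ring.
  have [a0 m0] : 0 <= k%:R :> R /\ 0 <= m%:R :> R by rewrite !ler0n.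
  rewrite -!natr1; move: (k%:R : R) (m%:R : R) a0 m0 => a c a0 c0.
  rewrite -subr_ge0.
  (* The square absorbs the negative part of the coefficient of [b]. *)
  have -> : ((a + 1) * x + b * (c + 1) * y) * ((a + 1) * x + b * (c + 1) * y) -
      (a * w + b * (c + 1 + 1) * x) * ((a + 1 + 1) * y + b * c * z) =
      a * (a + 2) * (x ^+ 2 - w * y) + b * (a * c) * (x * y - w * z) +
      b ^+ 2 * (c * (c + 2)) * (y ^+ 2 - x * z) + (x - b * y) ^+ 2 by ring.
  rewrite !addr_ge0 ?sqr_ge0 // mulr_ge0 ?subr_ge0 //.
  - by rewrite mulr_ge0 ?addr_ge0.
  - by rewrite !mulr_ge0 // ltW.
  - by rewrite mulr_ge0 ?sqr_ge0 // mulr_ge0 ?addr_ge0.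
Qed.

(** No matching has more than [n] edges and one has exactly [n], so the degree is [n]; hence the
    normalization by ['C(n, k)]. The leading coefficient is absorbed into [p]. *)
Lemma matching_newton (R : rcfType) (G : multigraph) (n : nat) :
  #|vert G| = (2 * n)%N -> (0 < phi n G)%N -> exists p : nat -> R, [/\
    forall k, (phi k G)%:R = 'C(n, k)%:R * p k,
    forall k, (k <= n)%N -> 0 < p k &
    forall k, (k.+2 <= n)%N -> p k * p k.+2 <= p k.+1 ^+ 2].
Proof.
move=> Gn phin; have [s s0 sE] := matching_poly_factor R G.
have [p [pE p0 pN]] := prod_XaddC_newton s0.
have szP : size (matching_poly G R) = n.+1.
  apply/eqP; rewrite eqn_leq; apply/andP; split.
    apply/leq_sizeP => l nl; rewrite coef_matching_poly phi_vanish //; lia.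
  rewrite ltnNge; apply/negP => /leq_sizeP/(_ n (leqnn n))/eqP.
  by rewrite coef_matching_poly pnatr_eq0; case: phi phin.
have lE : lead_coef (matching_poly G R) = (phi n G)%:R.
  by rewrite /lead_coef szP coef_matching_poly.
have l0 : 0 < lead_coef (matching_poly G R) by rewrite lE ltr0n.
have sn : size s = n.
  have := congr1 (fun P : {poly R} => size P) sE.
  rewrite szP size_scale ?gt_eqF // (eq_bigr (fun b => 'X - (- b)%:P)).
    by rewrite size_prod_XsubC => -[].
  by move=> b _; rewrite polyCN opprK.
rewrite sn in pE p0 pN; exists (fun k => (phi n G)%:R * p k); split.
- move=> k; rewrite -coef_matching_poly sE lE coefZ pE; ring.
- by move=> k /p0; apply: mulr_gt0; rewrite ltr0n.
- move=> k /pN pk; rewrite mulrACA exprMn -expr2 ler_wpM2l ?sqr_ge0 //.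
Qed.

(** * Perfect matchings of regular bipartite graphs *)

Section Hall.
Local Open Scope nat_scope.

Definition hall_condition (I V : finType) (N : I -> {set V}) :=
  forall A : {set I}, #|A| <= #|\bigcup_(i in A) N i|.

(* Rado's argument: if some [N i] has two elements, one of them can be deleted
   without destroying Hall's condition, by submodularity of the cardinal of
   the neighbourhood. *)
Theorem hall (I V : finType) (N : I -> {set V}) :
  hall_condition N -> exists2 f : I -> V, injective f & forall i, f i \in N i.
Proof.
have [k] := ubnP (\sum_i #|N i|); elim: k N => // k IH N Nk hN.
case: (pickP (fun i => 1 < #|N i|)) => [i /card_gt1P[a [b [aN bN ab]]]|N1].
  pose D c j := if j == i then N i :\ c else N j.
  have DE c (X : {set I}) : i \in X ->
      \bigcup_(j in X) D c j = (N i :\ c) :|: \bigcup_(j in X :\ i) N j.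
    move=> iX; rewrite (big_setD1 i iX) /= {1}/D eqxx; congr setU.
    by apply: eq_bigr => j; rewrite !inE /D => /andP[/negPf ->].
  have reduce c : c \in N i -> hall_condition (D c) ->
      exists2 f : I -> V, injective f & forall j, f j \in N j.
    move=> cN hD; case: (IH (D c)) => [|//|f f_inj fD].
      rewrite ltnS in Nk; apply: leq_trans Nk.
      rewrite (bigD1 i) //= [X in _ < X](bigD1 i) //= {1}/D eqxx.
      rewrite [in X in _ < X](cardsD1 c) cN -addnA add1n ltnS leq_add2l.
      by apply: leq_sum => j /negPf; rewrite /D => ->.
    exists f => // j; have := fD j; rewrite /D.
    by case: eqP => // -> /setD1P[].
  (* A set violating Hall's condition after the deletion contains [i], since away from [i] the
     neighbourhoods are unchanged. *)
  have witness c : c \in N i -> ~ hall_condition (D c) ->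
      exists2 X : {set I}, i \in X & #|\bigcup_(j in X) D c j| < #|X|.
    move=> cN hD; case: (pickP (fun X : {set I} =>
        #|\bigcup_(j in X) D c j| < #|X|)) => [X XD|nX]; last first.
      by case: hD => X; rewrite leqNgt nX.
    exists X => //; apply: contraLR XD => iX; rewrite -leqNgt.
    rewrite (eq_bigr N) ?hN // => j jX; rewrite /D.
    by case: eqP => // ji; rewrite -ji jX in iX.
  have dec c : hall_condition (D c) \/ ~ hall_condition (D c).
    have [h|h] := boolP [forall X : {set I}, #|X| <= #|\bigcup_(j in X) D c j|].
      by left; exact/forallP.
    by right=> hD; case/negP: h; apply/forallP.
  case: (dec a) => [/(reduce _ aN)//|/(witness _ aN)[A iA hA]].
  case: (dec b) => [/(reduce _ bN)//|/(witness _ bN)[B iB hB]].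
  (* [U] and [W] are the reduced neighbourhoods of [A] and [B]. As [a] and [b] differ, their union
     still contains all of [N i], so [hU] and [hI] give [|U| + |W| >= |A| + |B| - 1], while [hA] and
     [hB] give at most [|A| + |B| - 2]. *)
  exfalso; rewrite !DE // in hA hB.
  set U := _ :|: _ in hA; set W := _ :|: _ in hB.
  have hU : #|A :|: B| <= #|U :|: W|.
    apply: leq_trans (hN _) (subset_leq_card _); apply/bigcupsP => j jAB.
    apply/subsetP => x xj; rewrite !inE.
    have [ji|ji] := eqVneq j i.
      rewrite ji in xj; rewrite xj !andbT.
      by case: eqP => [->|]; rewrite ?ab ?orbT.
    move: jAB; rewrite inE => /orP[jA|jB]; apply/orP; [left|right];
      apply/orP; right; apply/bigcupP; exists j; rewrite ?inE ?ji //.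
  have hI : #|(A :&: B) :\ i| <= #|U :&: W|.
    apply: leq_trans (hN _) (subset_leq_card _); apply/bigcupsP => j.
    rewrite !inE => /and3P[ji jA jB]; rewrite subsetI.
    by apply/andP; split; apply: subset_trans (subsetUr _ _);
      apply: (bigcup_sup j); rewrite !inE ji.
  have := cardsD1 i (A :&: B); rewrite inE iA iB /=.
  have := cardsUI A B; have := cardsUI U W; lia.
(* Now every [N i] is a singleton, and Hall's condition on pairs makes the choice injective. *)
have N0 i : {x | N i = [set x]}.
  apply/sig_eqW/cards1P; rewrite eqn_leq leqNgt N1 /=.
  by have := hN [set i]; rewrite big_set1 cards1.
exists (fun i => sval (N0 i)) => [i j|i]; last by case: (N0 i) => x /= ->;
  rewrite set11.
case: (N0 i) => x /= Ni; case: (N0 j) => y /= Nj xy; apply/eqP/negPn/negP => ij.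
have := hN [set i; j]; rewrite cards2 ij bigcup_setU !big_set1 Ni Nj xy.
by rewrite setUid cards1.
Qed.

End Hall.

Section PerfectMatching.
Variables (n r : nat) (G : multigraph).
Local Open Scope nat_scope.

(** An edge has one end in [B], hence at most one in [X], so summing degrees over [X] counts each
    edge meeting [X] once. *)
Lemma card_edges_meeting (B X : {set vert G}) : regular r G ->
  (forall e : edge G, #|ends e :&: B| = 1) -> X \subset B ->
  #|[set e : edge G | ~~ [disjoint ends e & X]]| = r * #|X|.
Proof.
move=> Gr GB XB; rewrite mulnC -sum_nat_const.
rewrite (eq_bigr (fun v => \sum_e (v \in ends e : nat))); last first.
  by move=> v _; rewrite -(Gr v) -sum1_card big_mkcond; apply: eq_bigr => e _;
    rewrite inE.
rewrite exchange_big /= -sum1_card big_mkcond; apply: eq_bigr => e _.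
rewrite inE -setI_eq0 -cards_eq0.
transitivity #|ends e :&: X|.
  have : #|ends e :&: X| <= 1 by rewrite -(GB e) subset_leq_card ?setIS.
  by case: #|_| => [|[]].
rewrite -sum1_card -big_mkcondr; apply: eq_bigl => v /=.
by rewrite inE andbC.
Qed.

Lemma perfect_matching : 0 < r -> regular_bipartite (2 * n) r G -> 0 < phi n G.
Proof.
move=> r0 [Gn Gr [A GA]].
have GA1 e : #|ends e :&: A| = 1 by case: (GA e).
have GA2 e : #|ends e :&: ~: A| = 1 by rewrite -setDE; case: (GA e).
(* Every edge meets each side, so both sides account for the same number of edges, [r] per
   vertex. *)
have An : #|A| = n.
  have h1 := card_edges_meeting Gr GA1 (subxx A).
  have h2 := card_edges_meeting Gr GA2 (subxx (~: A)).
  have hE B : (forall e, #|ends e :&: B| = 1) ->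
      [set e : edge G | ~~ [disjoint ends e & B]] = setT.
    move=> GB; apply/setP => e; rewrite !inE -setI_eq0 -cards_eq0.
    by rewrite GB.
  rewrite !hE // in h1 h2; rewrite h1 in h2.
  move/eqP: h2; rewrite eqn_pmul2l // => /eqP h2.
  by have := cardsC A; rewrite Gn; lia.
pose N (x : {x | x \in A}) := [set w in ~: A | [exists e : edge G, (val x \in
  ends e) && (w \in ends e)]].
(* Every edge meeting [X] also meets its neighbourhood [Y], so [r * |X| <= r * |Y|]. *)
have hN : hall_condition N.
  move=> X; rewrite -(card_imset _ val_inj) -(leq_pmul2l r0).
  set Y := \bigcup_(i in X) N i.
  rewrite -(card_edges_meeting Gr GA1); last first.
    by apply/subsetP => _ /imsetP[[x xA] _ ->].
  rewrite -(card_edges_meeting Gr GA2); last first.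
    by apply/bigcupsP => x _; apply/subsetP => w; rewrite inE => /andP[].
  apply/subset_leq_card/subsetP => e; rewrite !inE -!setI_eq0.
  case/set0Pn => y /setIP[ye /imsetP[x xX xE]].
  have : ends e :&: ~: A != set0 by rewrite -cards_eq0 GA2.
  case/set0Pn => w /setIP[we wA]; apply/set0Pn; exists w; rewrite inE we.
  apply/bigcupP; exists x => //; rewrite inE wA.
  by apply/existsP; exists e; rewrite -xE ye.
have [f f_inj fN] := hall hN.
have /fin_all_exists[g gP] : forall x, exists e : edge G, ends e = [set val x;
  f x].
  move=> x; have := fN x; rewrite inE => /andP[fA /existsP[e /andP[xe fe]]].
  exists e; apply/esym/eqP;
    rewrite eqEcard subUset !sub1set xe fe card_ends cards2.
  have -> // : val x != f x; apply: contraTneq fA => <-.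
  by rewrite inE (valP x).
have dg x y : x != y -> [disjoint ends (g x) & ends (g y)].
  move=> xy; rewrite !gP; apply/pred0P => z /=; rewrite !inE.
  have fA u : f u \notin A by have := fN u; rewrite inE => /andP[+ _];
    rewrite inE.
  have vf (u v : {x | x \in A}) : val u != f v.
    by apply/eqP => uv; have := fA v; rewrite -uv (valP u).
  apply/negP => /andP[/orP[]/eqP-> /orP[]].
  - by rewrite val_eqE (negPf xy).
  - by rewrite (negPf (vf _ _)).
  - by rewrite eq_sym (negPf (vf _ _)).
  - by rewrite (inj_eq f_inj) (negPf xy).
have g_inj : injective g.
  move=> x y gxy; apply/eqP; apply: contraT => /dg; rewrite gxy.
  by rewrite -setI_eq0 setIid -cards_eq0 card_ends.
rewrite card_gt0; apply/set0Pn; exists (g @: setT); rewrite inE.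
rewrite card_imset // cardsT card_sig An eqxx andbT.
apply/matchingP => _ _ /imsetP[x _ ->] /imsetP[y _ ->] gxy.
by apply: dg; apply: contraNneq gxy => ->.
Qed.

End PerfectMatching.

(* Imported only here: its set operations shadow those of [finset]. *)
From mathcomp Require Import all_classical all_reals all_analysis.
Import numFieldNormedType.Exports.

(** * Discrete concavity of [ln (mu l n r) - ln 'C(n, l)] *)

Local Open Scope classical_set_scope.
Local Open Scope ring_scope.

(** The increments [d] decrease, so [d j] separates the slopes on the two sides of [j]. Denominators
    are cleared to allow coinciding indices. *)
Lemma discrete_concave (R : realFieldType) (g : nat -> R) (n i j k : nat) :
  (forall m, (m.+2 <= n)%N -> g m + g m.+2 <= 2 * g m.+1) ->
  (i <= j)%N -> (j <= k)%N -> (k <= n)%N ->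
  (k%:R - j%:R) * g i + (j%:R - i%:R) * g k <= (k%:R - i%:R) * g j.
Proof.
move=> gN ij jk kn; have [->|jk1] := eqVneq j k.
  by rewrite subrr mul0r add0r.
pose d m := g m.+1 - g m.
have dD m q : (m + q < n)%N -> d (m + q)%N <= d m.
  elim: q => [|q IH] mq; first by rewrite addn0.
  apply: le_trans (IH _); last lia.
  have := gN (m + q)%N; rewrite /d addnS => /(_ ltac:(lia)); lra.
have up q : (j + q <= n)%N -> g (j + q)%N - g j <= q%:R * d j.
  elim: q => [|q IH] jq; first by rewrite addn0 subrr mul0r.
  have := IH ltac:(lia); have := dD j q ltac:(lia).
  rewrite /d addnS -natr1 mulrDl mul1r; lra.
have dn q : (q <= j)%N -> q%:R * d j <= g j - g (j - q)%N.
  elim: q => [|q IH] jq; first by rewrite subn0 subrr mul0r.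
  have := IH ltac:(lia); have := dD (j - q.+1)%N q.+1 ltac:(lia).
  rewrite subnK // {2}/d (_ : (j - q.+1).+1 = j - q)%N; last lia.
  rewrite -natr1 mulrDl mul1r; lra.
have hi := dn (j - i)%N ltac:(lia); have hk := up (k - j)%N ltac:(lia).
rewrite natrB // subKn // in hi; rewrite natrB // subnKC // in hk.
have ij0 : 0 <= j%:R - i%:R :> R by rewrite subr_ge0 ler_nat.
have jk0 : 0 <= k%:R - j%:R :> R by rewrite subr_ge0 ler_nat.
have := ler_wpM2l jk0 hi; have := ler_wpM2l ij0 hk; nra.
Qed.

Lemma mu_le_phi (l n r : nat) (G : multigraph) :
  regular_bipartite (2 * n) r G -> (mu l n r <= phi l G)%N.
Proof.
move=> Gnr; rewrite /mu; case: ex_minnP => m _; apply.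
by apply/asboolP; exists G.
Qed.

Lemma mu_attained (l n r : nat) :
  exists2 G, regular_bipartite (2 * n) r G & phi l G = mu l n r.
Proof. by rewrite /mu; case: ex_minnP => m /asboolP[G GP <-] _; exists G. Qed.

Lemma ln_phi_concave (R : realType) (n r : nat) (G : multigraph) :
  (0 < r)%N -> regular_bipartite (2 * n) r G -> forall i j k : nat,
  let g l : R := ln (phi l G)%:R - ln 'C(n, l)%:R in
  (i <= j)%N -> (j <= k)%N -> (k <= n)%N ->
  (k%:R - j%:R) * g i + (j%:R - i%:R) * g k <= (k%:R - i%:R) * g j.
Proof.
move=> r0 Gnr i j k g; apply: discrete_concave => m mn.
have [p [pE p0 pN]] : _ := matching_newton R (let: And3 h _ _ := Gnr in h)
  (perfect_matching r0 Gnr).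
have gE l : (l <= n)%N -> g l = ln (p l).
  move=> ln0; rewrite /g pE lnM ?posrE ?p0 ?ltr0n ?bin_gt0 //.
  by rewrite addrC addKr.
rewrite !gE //; try lia.
have p1 : 0 < p m.+1 by apply: p0; lia.
rewrite -lnM ?posrE ?p0 //; try lia.
rewrite mulr_natl -lnXn // ler_ln ?posrE ?exprn_gt0 // ?mulr_gt0 ?p0 ?pN //;
  lia.
Qed.

Lemma mu_gt0 (l n r : nat) : (0 < r)%N -> (l <= n)%N -> (0 < mu l n r)%N.
Proof.
move=> r0 ln; have [G Gnr <-] := mu_attained l n r.
have [p [pE p0 _]] := matching_newton realalg (let: And3 h _ _ := Gnr in h)
  (perfect_matching r0 Gnr).
by rewrite -(ltr0n realalg) pE mulr_gt0 ?p0 // ltr0n bin_gt0.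
Qed.

(* A minimum of concave functions is concave: the graph attaining [mu j]
   bounds [mu i] and [mu k] from above. *)
Lemma ln_mu_concave (R : realType) (n r i j k : nat) :
  let g l : R := ln (mu l n r)%:R - ln 'C(n, l)%:R in
  (0 < r)%N -> (i <= j)%N -> (j <= k)%N -> (k <= n)%N ->
  (k%:R - j%:R) * g i + (j%:R - i%:R) * g k <= (k%:R - i%:R) * g j.
Proof.
move=> g r0 ij jk kn; have [G Gnr muE] := mu_attained j n r.
have := ln_phi_concave R r0 Gnr ij jk kn; rewrite /= muE => /(le_trans _);
  apply.
have muG l : (l <= n)%N -> g l <= ln (phi l G)%:R - ln 'C(n, l)%:R.
  move=> ln; have mu0 := mu_gt0 r0 ln; have mule := mu_le_phi l Gnr.
  by rewrite lerD2r ler_ln ?posrE ?ltr0n ?ler_nat // (leq_trans mu0).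
by apply: lerD; apply: ler_wpM2l; rewrite ?subr_ge0 ?ler_nat ?muG //; lia.
Qed.

Lemma ln_fact_bounds (R : realType) (n : nat) :
  n%:R * ln n%:R - n%:R <= ln n`!%:R :> R /\
  ln n`!%:R <= n%:R * ln n%:R - n%:R + (ln n.+1%:R + 1) :> R.
Proof.
have lnS m : (0 < m)%N -> m.+1%:R^-1 <= ln m.+1%:R - ln m%:R :> R /\
    ln m.+1%:R - ln m%:R <= m%:R^-1 :> R.
  move=> m0; have m0R : 0 < m%:R :> R by rewrite ltr0n.
  have m1R : 0 < m.+1%:R :> R by rewrite ltr0n.
  rewrite -ln_div ?posrE //; split.
    rewrite -[X in ln X]invf_div lnV ?posrE ?divr_gt0 // lerNr.
    have -> : m%:R / m.+1%:R = 1 + - m.+1%:R^-1 :> R.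
      by rewrite -natr1; field; rewrite natr1 gt_eqF.
    by rewrite le_ln1Dx // ltrN2 invf_lt1 // ltr1n ltnS.
  have -> : m.+1%:R / m%:R = 1 + m%:R^-1 :> R.
    by rewrite -natr1; field; rewrite gt_eqF.
  by rewrite le_ln1Dx // (lt_trans (ltrN10 _)) // invr_gt0.
have factS m : ln (m.+1)`!%:R = ln m.+1%:R + ln m`!%:R :> R.
  by rewrite factS natrM lnM ?posrE ?ltr0n ?fact_gt0.
split.
  elim: n => [|n IH]; first by rewrite mul0r subr0 fact0 ln1.
  rewrite factS; have [->|n0] := posnP n.
    by rewrite fact0 ln1; lra.
  have [_ h] := lnS _ n0; have n0R : 0 < n%:R :> R by rewrite ltr0n.
  have := ler_wpM2l (ltW n0R) h; rewrite mulfV ?gt_eqF // -natr1.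
  lra.
have up : ln n`!%:R <= n.+1%:R * ln n.+1%:R - n%:R :> R.
  elim: n => [|n IH]; first by rewrite fact0 ln1; lra.
  have [h _] := lnS n.+1 (ltn0Sn _);
    have n0R : 0 < n.+2%:R :> R by rewrite ltr0n.
  have := ler_wpM2l (ltW n0R) h; rewrite mulfV ?gt_eqF // factS.
  move: IH; rewrite -!natr1; lra.
apply: le_trans up _; have [->|n0] := posnP n; first by rewrite !mul0r ln1; lra.
have [_ h] := lnS _ n0; have n0R : 0 < n%:R :> R by rewrite ltr0n.
have := ler_wpM2l (ltW n0R) h; rewrite mulfV ?gt_eqF // -natr1; lra.
Qed.

Definition neg_entropy (R : realType) (p : R) : R :=
  p * ln p + (1 - p) * ln (1 - p).

Lemma ln_bin_bounds (R : realType) (n l : nat) : (l <= n)%N -> (0 < n)%N ->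
  `|ln 'C(n, l)%:R + n%:R * neg_entropy (l%:R / n%:R)| <=
    2 * (ln n.+1%:R + 1) :> R.
Proof.
move=> ln0 n0; have n0R : 0 < n%:R :> R by rewrite ltr0n.
have nN0 : n%:R != 0 :> R by rewrite gt_eqF.
have xlnx m : n%:R * (m%:R / n%:R * ln (m%:R / n%:R)) = m%:R * ln m%:R - m%:R *
  ln n%:R :> R.
  have [->|m0] := posnP m; first by rewrite !mul0r mulr0 subrr.
  by rewrite ln_div ?posrE ?ltr0n //; field.
have -> : n%:R * neg_entropy (l%:R / n%:R) =
    l%:R * ln l%:R + (n - l)%:R * ln (n - l)%:R - n%:R * ln n%:R :> R.
  rewrite /neg_entropy (_ : 1 - l%:R / n%:R = (n - l)%:R / n%:R :> R);
    last first.
    by rewrite natrB //; field.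
  by rewrite mulrDr !xlnx natrB //; ring.
have : ln n`!%:R = ln 'C(n, l)%:R + ln l`!%:R + ln (n - l)`!%:R :> R.
  rewrite -(bin_fact ln0) !natrM -!lnM ?posrE ?mulr_gt0 ?ltr0n ?fact_gt0
    ?bin_gt0 //.
  by rewrite mulrA.
have [] := ln_fact_bounds R n; have [] := ln_fact_bounds R l.
have [] := ln_fact_bounds R (n - l); rewrite natrB //.
have mono m : (m <= n)%N -> ln m.+1%:R <= ln n.+1%:R :> R.
  by move=> mn; rewrite ler_ln ?posrE ?ltr0n // ler_nat.
have := mono _ ln0; have := mono _ (leq_subr l n).
have : 0 <= ln n.+1%:R :> R by rewrite ln_ge0 // ler1n.
move=> *; rewrite ler_norml; apply/andP; split; lra.
Qed.

Lemma ln_le_sqrt (R : realType) (x : R) : 0 < x -> ln x <= 2 * Num.sqrt x.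
Proof.
move=> x0; have s0 : 0 < Num.sqrt x by rewrite sqrtr_gt0.
rewrite -[X in ln X](sqr_sqrtr (ltW x0)) lnXn // mulr2n.
have := ln_sublinear s0; lra.
Qed.

Lemma continuous_xlnx (R : realType) : continuous (fun x : R => x * ln x).
Proof.
move=> x; have [x0|x0|->] := ltgtP x 0.
- apply: (@cvg_near_cst R^o); rewrite (ln0 (ltW x0)) mulr0.
  near=> y; rewrite (@ln0 _ y) ?mulr0 //; near: y.
  by apply: filterS (lt_nbhsl x0) => y /ltW.
- by apply: cvgM; [exact: cvg_id|exact: continuous_ln].
- apply/cvgrPdist_le => e e0; near=> y.
  rewrite /= mul0r sub0r normrN; have [y0|y0] := leP y 0.
    by rewrite ln0 // mulr0 normr0 ltW.
  have y1 : y <= 1 by near: y; apply: filterS (lt_nbhsl ltr01) => y /ltW.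
  have ye : y <= (e / 2) ^+ 2.
    near: y; have h : 0 < (e / 2) ^+ 2 by rewrite exprn_gt0 // divr_gt0.
    by apply: filterS (lt_nbhsl h) => y /ltW.
  rewrite ler0_norm; last by rewrite mulr_ge0_le0 ?ln_le0 // ltW.
  rewrite -mulrN -lnV ?posrE //.
  apply: le_trans (ler_wpM2l (ltW y0) (ln_le_sqrt _)) _; rewrite ?invr_gt0 //.
  have s0 : 0 < Num.sqrt y by rewrite sqrtr_gt0.
  rewrite sqrtrV ?(ltW y0) // -{1}(sqr_sqrtr (ltW y0)).
  have -> : Num.sqrt y ^+ 2 * (2 * (Num.sqrt y)^-1) = 2 * Num.sqrt y.
    by field; rewrite gt_eqF.
  rewrite -ler_pdivlMl // mulrC.
  by rewrite -(@ler_sqrt _ y) ?exprn_ge0 ?divr_ge0 ?(ltW e0) // sqrtr_sqr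
    ger0_norm ?divr_ge0 ?(ltW e0) // in ye.
Unshelve. all: by end_near. Qed.

Lemma continuous_neg_entropy (R : realType) : continuous (@neg_entropy R).
Proof.
move=> x; apply: cvgD; first exact: continuous_xlnx.
apply: (@cvg_comp _ _ _ (fun x : R => 1 - x) (fun x : R => x * ln x) _ (nbhs (1
  - x))).
  by apply: cvgB; [exact: cvg_cst|exact: cvg_id].
exact: continuous_xlnx.
Qed.

Lemma cvg_lnS_div (R : realType) :
  2 * (ln n.+1%:R + 1) / n%:R @[n --> \oo] --> (0 : R).
Proof.
apply/cvgrPdist_le => e e0; near=> n.
have n0 : 0 < n%:R :> R by rewrite ltr0n; near: n; exists 1%N.
rewrite sub0r normrN ger0_norm; last first.
  by rewrite divr_ge0 ?mulr_ge0 ?addr_ge0 ?ln_ge0 ?ler1n ?ltW.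
rewrite ler_pdivrMr //.
have n1 : 1 <= n%:R :> R by rewrite ler1n -(ltr0n R).
have s1 : 1 <= Num.sqrt n.+1%:R :> R.
  by rewrite -{1}sqrtr1 ler_sqrt // ?ler1n // ltr0n.
have h := @ln_le_sqrt R n.+1%:R (ltr0Sn _ _).
have hn : (12 / e) ^+ 2 <= n%:R by near: n; exact: nbhs_infty_ger.
have h2 : 12 / e <= Num.sqrt n.+1%:R.
  rewrite -(@ger0_norm _ (12 / e)) ?divr_ge0 ?(ltW e0) // -sqrtr_sqr ler_sqrt
    ?ltr0n //.
  by apply: le_trans hn _; rewrite ler_nat.
have sq : Num.sqrt n.+1%:R ^+ 2 = n.+1%:R :> R by rewrite sqr_sqrtr.
rewrite ler_pdivrMr // in h2.
have h3 : 12 * Num.sqrt n.+1%:R <= Num.sqrt n.+1%:R ^+ 2 * e.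
  by rewrite expr2 -mulrA mulrCA mulrC ler_wpM2l ?sqrtr_ge0.
rewrite sq -natr1 in h3.
have : (n%:R + 1) * e <= 2 * n%:R * e by rewrite ler_pM2r //; lra.
rewrite -natr1 in h h3 s1 *; lra.
Unshelve. all: by end_near. Qed.

Lemma near_infty_gt0 (n : nat -> nat) :
  n k @[k --> \oo] --> \oo -> \forall k \near \oo, (0 < n k)%N.
Proof. by move=> /(_ [set m | (0 < m)%N]); apply; exists 1%N. Qed.

Lemma cvg_ln_bin (R : realType) (p : R) (n l : nat -> nat) :
  admissible p n l ->
  ln 'C(n k, l k)%:R / (n k)%:R @[k --> \oo] --> - neg_entropy p.
Proof.
move=> [noo ln_ lnp].
have hH : neg_entropy ((l k)%:R / (n k)%:R) @[k --> \oo] --> neg_entropy p.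
  by apply: continuous_cvg lnp; exact: continuous_neg_entropy.
have hE : 2 * (ln (n k).+1%:R + 1) / (n k)%:R @[k --> \oo] --> (0 : R).
  exact: (cvg_comp _ _ noo (@cvg_lnS_div R)).
rewrite -[X in _ --> X]add0r.
have -> : (fun k => ln 'C(n k, l k)%:R / (n k)%:R) =
    (fun k => (ln 'C(n k, l k)%:R / (n k)%:R + neg_entropy ((l k)%:R / (n
      k)%:R)) -
       neg_entropy ((l k)%:R / (n k)%:R) : R).
  by apply/funext => k; rewrite addrK.
apply: cvgB hH; apply/cvgrPdist_le => e e0; near=> k.
have n0 : (0 < n k)%N by near: k; exact: near_infty_gt0.
have n0R : 0 < (n k)%:R :> R by rewrite ltr0n.
have h := @ln_bin_bounds R _ _ (ln_ k) n0.
rewrite sub0r normrN;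
  apply: (@le_trans _ _ (2 * (ln (n k).+1%:R + 1) / (n k)%:R)).
  rewrite ler_pdivlMr // -[X in _ * X](ger0_norm (ltW n0R)) -normrM mulrDl
    divfK ?gt_eqF //.
  by rewrite [X in _ + X]mulrC.
near: k; move/cvgrPdist_le : hE => /(_ e e0); apply: filterS => k.
by rewrite sub0r normrN => /(le_trans (ler_norm _)).
Unshelve. all: by end_near. Qed.

Lemma cvg_truncn_div (R : realType) (p : R) (n : nat -> nat) : 0 <= p <= 1 ->
  n k @[k --> \oo] --> \oo ->
  admissible p n (fun k => Num.truncn (p * (n k)%:R)).
Proof.
move=> /andP[p0 p1] noo; split => //.
  move=> k; rewrite -(ler_nat R).
  apply: le_trans (_ : p * (n k)%:R <= _); last by rewrite ler_piMl.
  by rewrite truncn_le mulr_ge0.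
apply: (@squeeze_cvgr _ _ _ _ (fun k => p - (n k)%:R^-1) (fun=> p)).
- near=> k.
  have k0 : 0 < (n k)%:R :> R.
    by rewrite ltr0n; near: k; exact: near_infty_gt0.
  have /andP[h1 h2] := truncn_itv (mulr_ge0 p0 (ltW k0)).
  rewrite ler_pdivrMr// h1 andbT ler_pdivlMr// mulrBl mulVf ?gt_eqF//.
  by rewrite lerBlDr natr1 ltW.
- rewrite -[X in _ --> X]subr0; apply: cvgB; first exact: cvg_cst.
  apply: (cvg_comp _ _ noo (_ : (fun m : nat => m%:R^-1 : R) @ \oo --> 0)).
  by rewrite -cvg_shiftS /=; exact: cvg_harmonic.
- exact: cvg_cst.
Unshelve. all: by end_near. Qed.

(** * Lower limits *)

Lemma low_le_density (R : realType) (r : nat) (p : R) (n l : nat -> nat) (e :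
  R) :
  0 <= p <= 1 -> admissible p n l -> 0 < e ->
  \forall k \near \oo, low r p - e <= log_mu_density R r n l k.
Proof.
move=> p01 nl e0; have fn := elow_fin_num r p01.
set u := EFin \o log_mu_density R r n l.
have : (elow r p <= limn_einf u)%E by apply: ereal_inf_lbound; exists n, l.
rewrite limn_einf_lim (cvg_lim _ (@cvg_einfs_sup _ u)) // => h.
have : ((low r p - e)%:E < ereal_sup (range (einfs u)))%E.
  apply: lt_le_trans h; rewrite /low -[X in (_ < X)%E](fineK fn) lte_fin.
  by rewrite ltrBlDr ltrDl.
move=> /ereal_sup_gt[_ [N _ <-] hN]; exists N => // k /= Nk.
rewrite -lee_fin; apply: (le_trans (ltW hN)).
by apply: ereal_inf_lbound; exists k.
Qed.

Lemma low_ge (R : realType) (r : nat) (p c : R) : 0 <= p <= 1 ->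
  (forall n l, admissible p n l -> forall e, 0 < e ->
     \forall k \near \oo, c - e <= log_mu_density R r n l k) ->
  c <= low r p.
Proof.
move=> p01 h; rewrite -lee_fin /low fineK ?elow_fin_num //.
apply: le_ereal_inf_tmp => _ [n [l [nl ->]]].
rewrite limn_einf_lim (cvg_lim _ (@cvg_einfs_sup _ _)) //.
apply/lee_addgt0Pr => e e0; rewrite -leeBlDr // -EFinB.
have [N _ hN] := h _ _ nl _ e0.
apply: le_trans (ereal_sup_ubound _); last by exists N.
apply: le_ereal_inf_tmp => _ [k /= Nk <-].
by rewrite lee_fin hN.
Qed.

Lemma density_interpolation (R : realType) (r : nat) (n i j k : nat -> nat) (m
  : nat) :
  let w : R := ((k m)%:R / (n m)%:R - (j m)%:R / (n m)%:R) /
               ((k m)%:R / (n m)%:R - (i m)%:R / (n m)%:R) in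
  let c (l : nat -> nat) : R := ln 'C(n m, l m)%:R / (n m)%:R in
  (0 < r)%N -> (0 < n m)%N ->
  (i m < j m)%N -> (j m < k m)%N -> (k m <= n m)%N ->
  w * log_mu_density R r n i m + (1 - w) * log_mu_density R r n k m +
    2^-1 * (c j - w * c i - (1 - w) * c k) <= log_mu_density R r n j m.
Proof.
move=> w c r0 n0 ij jk kn.
have n0R : 0 < (n m)%:R :> R by rewrite ltr0n.
have ik0 : 0 < (k m)%:R - (i m)%:R :> R by rewrite subr_gt0 ltr_nat; lia.
have := ln_mu_concave R r0 (ltnW ij) (ltnW jk) kn.
set gi := ln _ - ln _; set gk := ln _ - ln _; set gj := ln _ - ln _ => h.
have nN0 : (n m)%:R != 0 :> R by rewrite gt_eqF.
have ikN0 : (k m)%:R - (i m)%:R != 0 :> R by rewrite gt_eqF.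
have wE : w = ((k m)%:R - (j m)%:R) / ((k m)%:R - (i m)%:R).
  by rewrite /w -!mulrBl -mulf_div divff ?mulr1 ?invr_eq0.
have w1E : 1 - w = ((j m)%:R - (i m)%:R) / ((k m)%:R - (i m)%:R).
  by rewrite wE; field.
have {}h : w * gi + (1 - w) * gk <= gj.
  by rewrite w1E wE mulrAC [X in _ + X]mulrAC -mulrDl ler_pdivrMr // [X in _ <=
    X]mulrC.
have E (l : nat -> nat) : log_mu_density R r n l m =
    (ln (mu (l m) (n m) r)%:R - ln 'C(n m, l m)%:R) / (n m)%:R / 2 + 2^-1 * c l.
  by rewrite /log_mu_density /c natrM; field.
rewrite !E -/gi -/gj -/gk.
have {h} : w * (gi / (n m)%:R) + (1 - w) * (gk / (n m)%:R) <= gj / (n m)%:R.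
  by rewrite !mulrA -mulrDl ler_pM2r ?invr_gt0.
move: (gi / _) (gk / _) (gj / _) (c i) (c j) (c k) => a b d ci cj ck; lra.
Qed.

(* If [l'_k], [l''_k] are the truncations of [x n_k] and [y n_k], the same [n_k]
   serves all three points, and [l_k] is the barycentre of [l'_k] and [l''_k]
   with weights [w k, 1 - w k] tending to [t, 1 - t]. *)
Lemma low_concave_lt (R : realType) (r : nat) (x y z t : R) : (0 < r)%N ->
  0 <= x -> x < y -> y <= 1 -> 0 < t < 1 ->
  z = t * x + (1 - t) * y ->
  t * (low r x + 2^-1 * neg_entropy x) +
    (1 - t) * (low r y + 2^-1 * neg_entropy y) <=
  low r z + 2^-1 * neg_entropy z.
Proof.
move=> r0 x0 xy y1 /andP[t0 t1] zE.
have x01 : 0 <= x <= 1 by lra.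
have y01 : 0 <= y <= 1 by lra.
have xz : x < z by rewrite zE; nra.
have zy : z < y by rewrite zE; nra.
have z01 : 0 <= z <= 1 by lra.
rewrite -lerBlDr; apply: low_ge => // n j jz e e0.
have [noo jn jzc] := jz.
have := cvg_truncn_div x01 noo; set i := fun k => _ => ix.
have := cvg_truncn_div y01 noo; set k := fun k => _ => ky.
have [_ _ ixc] := ix; have [_ kn kyc] := ky.
pose w m : R := ((k m)%:R / (n m)%:R - (j m)%:R / (n m)%:R) /
                ((k m)%:R / (n m)%:R - (i m)%:R / (n m)%:R).
have wt : w m @[m --> \oo] --> t.
  have -> : t = (y - z) / (y - x) by rewrite zE; field; rewrite subr_eq0 gt_eqF.
  apply: cvgM; first exact: cvgB.
  by apply: cvgV; [rewrite subr_eq0 gt_eqF|exact: cvgB].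
have w1t : 1 - w m @[m --> \oo] --> 1 - t by apply: cvgB => //; exact: cvg_cst.
have ci := cvg_ln_bin ix; have cj := cvg_ln_bin jz; have ck := cvg_ln_bin ky.
pose F m := w m * (low r x - e / 2) + (1 - w m) * (low r y - e / 2) +
  2^-1 * (ln 'C(n m, j m)%:R / (n m)%:R - w m * (ln 'C(n m, i m)%:R / (n m)%:R)
    -
    (1 - w m) * (ln 'C(n m, k m)%:R / (n m)%:R)).
have Fc : F m @[m --> \oo] --> t * (low r x - e / 2) + (1 - t) * (low r y - e /
  2) +
    2^-1 * (- neg_entropy z - t * (- neg_entropy x) - (1 - t) * (- neg_entropy
      y)).
  apply: cvgD.
    by apply: cvgD; apply: cvgMl.
  apply: cvgMr; apply: cvgB; last exact: cvgM.
  by apply: cvgB => //; exact: cvgM.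
have e2 : 0 < e / 2 by rewrite divr_gt0.
near=> m.
have n0 : (0 < n m)%N by near: m; exact: near_infty_gt0.
have n0R : 0 < (n m)%:R :> R by rewrite ltr0n.
have ij : (i m < j m)%N.
  have : (i m)%:R / (n m)%:R < (j m)%:R / (n m)%:R :> R.
    near: m.
    have h1 : x < (x + z) / 2 by lra.
    have h2 : (x + z) / 2 < z by lra.
    by apply: (filterS2 _ _ (cvgr_lt _ ixc _ h1) (cvgr_gt _ jzc _ h2)) => m;
      apply: lt_trans.
  by rewrite ltr_pM2r ?invr_gt0 // ltr_nat.
have jk : (j m < k m)%N.
  have : (j m)%:R / (n m)%:R < (k m)%:R / (n m)%:R :> R.
    near: m.
    have h1 : z < (z + y) / 2 by lra.
    have h2 : (z + y) / 2 < y by lra.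
    by apply: (filterS2 _ _ (cvgr_lt _ jzc _ h1) (cvgr_gt _ kyc _ h2)) => m;
      apply: lt_trans.
  by rewrite ltr_pM2r ?invr_gt0 // ltr_nat.
apply: le_trans (density_interpolation R r0 n0 ij jk (kn m)).
have di : low r x - e / 2 <= log_mu_density R r n i m.
  by near: m; exact: low_le_density.
have dk : low r y - e / 2 <= log_mu_density R r n k m.
  by near: m; exact: low_le_density.
have Fm : t * (low r x - e / 2) + (1 - t) * (low r y - e / 2) +
    2^-1 * (- neg_entropy z - t * (- neg_entropy x) -
      (1 - t) * (- neg_entropy y)) - e / 2 <= F m.
  by near: m; apply: (cvgr_ge _ Fc); rewrite ltrBlDr ltrDl.
have w01 : 0 <= w m <= 1.
  have a0 : 0 <= (k m)%:R / (n m)%:R - (j m)%:R / (n m)%:R :> R.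
    by rewrite -mulrBl divr_ge0 // ?subr_ge0 ?ler_nat ?ltW // ltnW.
  have b0 : (k m)%:R / (n m)%:R - (j m)%:R / (n m)%:R <=
      (k m)%:R / (n m)%:R - (i m)%:R / (n m)%:R :> R.
    by rewrite lerD2l lerN2 ler_pM2r ?invr_gt0 // ler_nat ltnW.
  have c0 : 0 < (k m)%:R / (n m)%:R - (i m)%:R / (n m)%:R :> R.
    by rewrite -mulrBl divr_gt0 // subr_gt0 ltr_nat; lia.
  by rewrite /w divr_ge0 ?(le_trans a0) // ler_pdivrMr // mul1r.
rewrite -/(w m); move/andP: w01 => [w0 w1].
have := ler_wpM2l w0 di.
have w10 : 0 <= 1 - w m by rewrite subr_ge0.
have := ler_wpM2l w10 dk.
move: Fm; rewrite /F; lra.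
Unshelve. all: by end_near. Qed.

Theorem theorem3p1 (R : realType) (r : nat) (hr : (2 <= r)%N) :
  concave_function (`[0, 1] : set R^o)
    (fun p : R^o => low r p + 2^-1 * (p * ln p + (1 - p) * ln (1 - p))).
Proof.
move=> t x y; rewrite !inE /= !in_itv /= => /andP[x0 x1] /andP[y0 y1].
have r0 : (0 < r)%N by exact: ltn_trans hr.
change (t%:inum * (low r x + 2^-1 * neg_entropy x) +
  (1 - t%:inum) * (low r y + 2^-1 * neg_entropy y) <=
  low r (t%:inum * x + (1 - t%:inum) * y) +
    2^-1 * neg_entropy (t%:inum * x + (1 - t%:inum) * y)).
have [s0 s1] : 0 <= t%:inum /\ t%:inum <= 1 by [].
move: (t%:inum) s0 s1 => s s0 s1.
have [->|sN0] := eqVneq s 0; first by rewrite !mul0r !add0r subr0 !mul1r.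
have [->|sN1] := eqVneq s 1; first by rewrite subrr !mul0r !addr0 !mul1r.
have s01 : 0 < s < 1 by rewrite !lt_def sN0 s0 eq_sym sN1 s1.
have [xy|xy|->] := ltgtP x y.
- exact: low_concave_lt s01 erefl.
- have s01' : 0 < 1 - s < 1 by lra.
  have zE : s * x + (1 - s) * y = (1 - s) * y + (1 - (1 - s)) * x by ring.
  by have := low_concave_lt r0 y0 xy x1 s01' zE;
    rewrite subKr [X in X <= _]addrC.
- by rewrite -!mulrDl subrKC !mul1r.
Qed.
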